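(* Let $A \in \mathbb{R}^{n\times n}$ and $\eta \in (0,1)$. The following statements are equivalent: (i) the linear mapping $\mathcal{A}: \mathbb{R}^n \to \mathbb{R}^n$, $x \mapsto Ax$, is $\eta$-averaged with respect to some Hilbert norm on $\mathbb{R}^n$; (ii) there exists a symmetric positive definite matrix $P \in \mathbb{R}^{n\times n}$ such that $$A^\top P A \preccurlyeq (2\eta - 1) P + (1-\eta)\left(A^\top P + P A\right);$$ (iii) the linear mapping $\mathcal{A}_\eta: x \mapsto A_\eta x$, with $A_\eta := \left(1 - \tfrac{1}{\eta}\right) I + \tfrac{1}{\eta} A$, is nonexpansive with respect to some Hilbert norm on $\mathbb{R}^n$; (iv) every eigenvalue of $A$ lies in the disk $\mathbb{D}_\eta := \{ z \in \mathbb{C} : |z - (1-\eta)| \le \eta\}$, and every eigenvalue of $A$ lying on the boundary of $\mathbb{D}_\eta$ is semi-simple.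
   Context: A Hilbert norm on $\mathbb{R}^n$ is a norm induced by an inner product (equivalently, of the form $\|x\|_P = \sqrt{x^\top P x}$ with $P$ symmetric positive definite). For $\eta \in (0,1)$, a Lipschitz continuous mapping $\mathcal{T}:\mathbb{R}^n\to\mathbb{R}^n$ is $\eta$-averaged with respect to $\|\cdot\|$ if for all $x,y \in \mathbb{R}^n$ $$\|\mathcal{T}(x)-\mathcal{T}(y)\|^2 \le \|x-y\|^2 - \tfrac{1-\eta}{\eta} \,\|(\mathrm{Id}-\mathcal{T})(x) - (\mathrm{Id}-\mathcal{T})(y)\|^2 ,$$ where $\mathrm{Id}$ is the identity operator. $\mathcal{T}$ is nonexpansive with respect to $\|\cdot\|$ if $\|\mathcal{T}(x)-\mathcal{T}(y)\| \le \|x-y\|$ for all $x,y$. An eigenvalue of $A$ (over $\mathbb{C}$) is semi-simple if its algebraic and geometric multiplicities are equal. $X \preccurlyeq Y$ means that $Y-X$ is positive semidefinite. *)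

(* Defs.v *)
(* MathComp, with the reals an arbitrary [R : realType] and the complex numbers
   the type [R[i]] of mathcomp-real-closed. *)
From HB Require Import structures.
From mathcomp Require Import all_boot all_order all_algebra.
From mathcomp Require Import complex reals.
Set Implicit Arguments.
Unset Strict Implicit.
Unset Printing Implicit Defensive.
Import Order.TTheory GRing.Theory Num.Theory.
Local Open Scope ring_scope.
Local Open Scope complex_scope.

(* [{dot V for idfun}] is the type of symmetric positive definite bilinear
   forms on [V], i.e. of real inner products. *)
Definition hilbert_norm (R : realType) (n : nat) (N : 'cV[R]_n -> R) : Prop :=
  exists ip : {dot 'cV[R]_n for idfun}, forall x, N x = Num.sqrt (ip x x).

Definition lipschitz_wrt (R : realType) (n : nat) (N : 'cV[R]_n -> R)
    (T : 'cV[R]_n -> 'cV[R]_n) : Prop :=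
  exists2 L : R, 0 <= L & forall x y, N (T x - T y) <= L * N (x - y).

Definition averaged (R : realType) (n : nat) (eta : R) (N : 'cV[R]_n -> R)
    (T : 'cV[R]_n -> 'cV[R]_n) : Prop :=
  lipschitz_wrt N T /\
  forall x y, N (T x - T y) ^+ 2 <=
    N (x - y) ^+ 2 - (1 - eta) / eta * N ((x - T x) - (y - T y)) ^+ 2.

Definition nonexpansive (R : realType) (n : nat) (N : 'cV[R]_n -> R)
    (T : 'cV[R]_n -> 'cV[R]_n) : Prop :=
  forall x y, N (T x - T y) <= N (x - y).

Definition sym_posdef (R : realType) (n : nat) (P : 'M[R]_n) : Prop :=
  P^T = P /\ forall x : 'cV[R]_n, x != 0 -> 0 < (x^T *m P *m x) 0 0.

Definition possemidef (R : realType) (n : nat) (P : 'M[R]_n) : Prop :=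
  P^T = P /\ forall x : 'cV[R]_n, 0 <= (x^T *m P *m x) 0 0.

Definition loewner_le (R : realType) (n : nat) (X Y : 'M[R]_n) : Prop :=
  possemidef (Y - X).

Definition to_complex (R : realType) (n : nat) (A : 'M[R]_n) : 'M[R[i]]_n :=
  map_mx (real_complex R) A.

(* The library's [eigenvalue] and [eigenspace] are about row vectors acted on
   from the right; the transposes make them those of [x |-> A x] on columns. *)
Definition complex_eigenvalue (R : realType) (n : nat) (A : 'M[R]_n)
    (z : R[i]) : Prop :=
  eigenvalue (to_complex A)^T z.

Definition algebraic_multiplicity (R : realType) (n : nat) (A : 'M[R]_n)
    (z : R[i]) : nat :=
  mup z (char_poly (to_complex A)).

Definition geometric_multiplicity (R : realType) (n : nat) (A : 'M[R]_n)
    (z : R[i]) : nat :=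
  \rank (eigenspace (to_complex A)^T z).

Definition semisimple_eigenvalue (R : realType) (n : nat) (A : 'M[R]_n)
    (z : R[i]) : Prop :=
  algebraic_multiplicity A z = geometric_multiplicity A z.

(* On [R[i]] the modulus is [R[i]]-valued, and [a <= b] means that [b - a] is
   real and nonnegative. *)
Definition in_disk (R : realType) (eta : R) (z : R[i]) : Prop :=
  `|z - (1 - eta)%:C| <= eta%:C.

Definition on_disk_boundary (R : realType) (eta : R) (z : R[i]) : Prop :=
  `|z - (1 - eta)%:C| = eta%:C.

(* Main.v *)
(* In an inner product norm, both the averagedness of A and the nonexpansiveness
   of A_eta expand to |(A - c) x| <= eta |x| with c = 1 - eta, which is also the
   matrix inequality (ii).  Everything thus reduces to the following statement
   about a complex matrix M = A - c: it is r-Lipschitz for some Hermitian norm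
   iff its eigenvalues satisfy |l| <= r, with semi-simplicity when |l| = r.

   If M is r-Lipschitz, |l| = r, w = (M - l) u and (M - l) w = 0, one may choose
   u orthogonal to w; then |M u|^2 = r^2 |u|^2 + |w|^2 forces w = 0.

   Conversely, let q_l = prod_(l' <> l) (X - l')^n over the distinct eigenvalues
   and Z = M - l.  The norm is sum_l sum_k t_l^k |Z^k q_l(M) x|^2: by
   Cayley-Hamilton Z is nilpotent on the range of q_l(M), so on each block Z has
   norm at most t_l^(-1/2), which is made small when |l| < r, while semi-simplicity
   gives Z q_l(M) = 0 when |l| = r.  The form is definite because a nonzero x
   killed by all the q_l(M) would yield an eigenvector of M killed by them all. *)
Require Import Defs.
From HB Require Import structures.
From mathcomp Require Import all_boot all_order all_algebra.
From mathcomp Require Import complex reals ring.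
Set Implicit Arguments.
Unset Strict Implicit.
Unset Printing Implicit Defensive.
Import Order.TTheory GRing.Theory Num.Theory.
Local Open Scope ring_scope.
Local Open Scope complex_scope.

(** * Multiplicities and eigenvectors *)

Lemma char_poly_trmx (F : comNzRingType) n (f : 'M[F]_n) : char_poly f^T = char_poly f.
Proof.
rewrite /char_poly -det_tr /char_poly_mx raddfB /= tr_scalar_mx.
by rewrite -map_trmx trmxK.
Qed.

Lemma eigenvalue_shift (F : fieldType) n (f : 'M[F]_n) (c l : F) :
  eigenvalue (f - c%:M) l = eigenvalue f (l + c).
Proof.
rewrite /eigenvalue /eigenspace.
by rewrite -addrA -opprD -raddfD [c + l]addrC.
Qed.

(** The sizes are linked by an equation because the basis used below has [\rank E + \rank W] rows,
    which equals [n] only propositionally. *)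
Lemma char_poly_similar (F : fieldType) (m n : nat) (V : 'M[F]_(m, n))
    (f : 'M[F]_n) (g : 'M[F]_m) :
  m = n -> row_free V -> V *m f = g *m V -> char_poly f = char_poly g.
Proof.
move=> mn; subst m; rewrite row_free_unit => Vu fg.
have Pu : map_mx polyC V \in unitmx.
  by rewrite unitmxE det_map_mx rmorph_unit // -unitmxE.
have eqP' : map_mx polyC V *m char_poly_mx f = char_poly_mx g *m map_mx polyC V.
  rewrite /char_poly_mx mulmxBr mulmxBl -!map_mxM fg.
  by rewrite scalar_mxC.
have := congr1 determinant eqP'; rewrite !det_mulmx mulrC.
by apply: mulIr; rewrite -unitmxE.
Qed.

Lemma char_poly_lblock (F : fieldType) (m n : nat) (a : 'M[F]_m)
    (b : 'M[F]_(n, m)) (c : 'M[F]_n) :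
  char_poly (block_mx a 0 b c) = char_poly a * char_poly c.
Proof.
rewrite /char_poly /char_poly_mx scalar_mx_block map_block_mx opp_block_mx.
by rewrite add_block_mx map_mx0 oppr0 addr0 det_lblock.
Qed.

Lemma mup_scalar_block (F : fieldType) (d n : nat) (z : F) (b : 'M[F]_(n, d))
    (c : 'M[F]_n) :
  mup z (char_poly (block_mx z%:M 0 b c)) = (d + mup z (char_poly c))%N.
Proof.
rewrite char_poly_lblock mupM ?monic_neq0 ?char_poly_monic //; congr addn.
rewrite char_poly_trig ?scalar_mx_is_trig //.
under eq_bigr do rewrite mxE eqxx mulr1n.
by rewrite prodr_const card_ord mup_XsubCX eqxx.
Qed.

(* In a basis extending one of the eigenspace, f is [[z, 0], [b, c]]; both sides say
   that z is not an eigenvalue of c. *)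
Lemma mup_eigenspace_rank (F : fieldType) (n : nat) (f : 'M[F]_n) (z : F) :
  mup z (char_poly f) = \rank (eigenspace f z) <->
  (forall v : 'rV_n, v *m (f - z%:M) *m (f - z%:M) = 0 -> v *m (f - z%:M) = 0).
Proof.
set E := eigenspace f z; set W := (E^C)%MS.
pose V := col_mx (row_base E) (row_base W).
have szV : (\rank E + \rank W = n)%N by rewrite mxrank_compl subnKC ?rank_leq_row.
have fullV : row_full V.
  rewrite -sub1mx -addsmxE (adds_eqmx (eq_row_base E) (eq_row_base W)).
  by rewrite submx_full // addsmx_compl_full.
have freeV : row_free V by rewrite /row_free [X in _ == X]szV.
(* [g] is the matrix of [f] in the basis [V], whose rows span first [E], then its complement [W]. *)
pose g := V *m f *m pinvmx V.
have Vf : V *m f = g *m V by rewrite mulmxKpV // submx_full.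
have eigE : row_base E *m f = z *: row_base E.
  by apply/eigenspaceP; rewrite eq_row_base.
pose b := dlsubmx g; pose c := drsubmx g.
have gE : g = block_mx z%:M 0 b c.
  rewrite -[LHS]submxK -/b -/c; suff : usubmx g = row_mx z%:M 0.
    by rewrite /ulsubmx /ursubmx => ->; rewrite row_mxKl row_mxKr.
  apply: (row_free_inj freeV); rewrite mul_usub_mx -Vf -mul_usub_mx col_mxKu.
  by rewrite eigE mul_row_col mul_scalar_mx mul0mx addr0.
rewrite (char_poly_similar szV freeV Vf) gE mup_scalar_block.
have gz : V *m (f - z%:M) = block_mx 0 0 b (c - z%:M) *m V.
  rewrite mulmxBr Vf scalar_mxC -mulmxBl gE scalar_mx_block opp_block_mx.
  by rewrite add_block_mx !subrr !subr0.
split.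
  move/eqP; rewrite -[X in _ == X]addn0 eqn_add2l => /eqP m0 v.
  have cz0 (w : 'rV_(\rank W)) : w *m (c - z%:M) = 0 -> w = 0.
    move=> wc; apply/eqP; apply: contraTT isT => w0.
    have : eigenvalue c z.
      apply/eigenvalueP; exists w => //; apply/eqP.
      by rewrite -subr_eq0 -mul_mx_scalar -mulmxBr wc.
    by rewrite eigenvalue_root_char -dvdp_XsubCl XsubC_dvd
      ?monic_neq0 ?char_poly_monic // m0.
  have /submxP[u ->] : (v <= V)%MS by rewrite submx_full.
  rewrite -(mulmxA u) gz (mulmxA u) -mulmxA gz mulmxA -[u]hsubmxK.
  rewrite !mul_row_block !mulmx0 !add0r.
  move=> /eqP; rewrite -[X in _ == X](mul0mx _ V) => /eqP/(row_free_inj freeV).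
  rewrite -row_mx0 => /eq_row_mx[_ /cz0/cz0 ->].
  by rewrite !mul0mx row_mx0 mul0mx.
move=> ker; apply/eqP; rewrite -[X in _ == X]addn0 eqn_add2l; apply/eqP.
apply: mupNroot; rewrite -eigenvalue_root_char; apply/negP.
move=> /eigenvalueP[w wc w0].
have wcz : w *m (c - z%:M) = 0 by rewrite mulmxBr wc mul_mx_scalar subrr.
(* Padded with zeros, the eigenvector [w] of [c] gives a vector killed by the square of [f - z%:M];
   by [ker] it lies in [E], which forces [w = 0]. *)
pose u := row_mx (0 : 'rV_(\rank E)) w.
have uV : u *m V *m (f - z%:M) = row_mx (w *m b) 0 *m V.
  by rewrite -mulmxA gz mulmxA mul_row_block !mulmx0 !add0r wcz.
have /ker : u *m V *m (f - z%:M) *m (f - z%:M) = 0.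
  by rewrite uV -mulmxA gz mulmxA mul_row_block !mulmx0 !mul0mx !add0r row_mx0 mul0mx.
rewrite mulmxBr mul_mx_scalar => /eqP; rewrite subr_eq0 => /eqP/eigenspaceP.
rewrite -/E -(eq_row_base E) => /submxP[a aE].
have : u *m V = row_mx a 0 *m V by rewrite [RHS]mul_row_col mul0mx addr0.
by move/(row_free_inj freeV)/eq_row_mx => [_ /eqP]; apply/negP.
Qed.

Lemma horner_mx_eigenvector (F : fieldType) (n : nat) (f : 'M[F]_n.+1) (z : F)
    (v : 'rV_n.+1) (p : {poly F}) :
  v *m f = z *: v -> v *m horner_mx f p = p.[z] *: v.
Proof.
move=> vf; elim/poly_ind: p => [|p c IHp].
  by rewrite rmorph0 mulmx0 horner0 scale0r.
rewrite rmorphD rmorphM /= horner_mx_X horner_mx_C mulmxDr mulmxA IHp.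
by rewrite -scalemxAl vf mul_mx_scalar hornerMXaddC scalerA -scalerDl.
Qed.

(** Apply the linear factors to [v] one after another: the last nonzero vector is an eigenvector for
    the next root, and [p] collects the factors applied so far. *)
Lemma exists_eigenvector_horner (F : fieldType) (n : nat) (f : 'M[F]_n.+1)
    (s : seq F) (v : 'rV_n.+1) :
  v != 0 -> v *m horner_mx f (\prod_(z <- s) ('X - z%:P)) = 0 ->
  exists p z, [/\ z \in s, v *m horner_mx f p != 0 &
    v *m horner_mx f p *m f = z *: (v *m horner_mx f p)].
Proof.
elim: s v => [|z s IHs] v v0.
  by rewrite big_nil rmorph1 mulmx1 (rwP eqP) (negPf v0).
rewrite big_cons rmorphM /= mulmxA.
have [vz _|vz] := eqVneq (v *m horner_mx f ('X - z%:P)) 0.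
  exists 1, z; rewrite rmorph1 mulmx1 mem_head; split=> //.
  move: vz; rewrite rmorphB /= horner_mx_X horner_mx_C mulmxBr mul_mx_scalar.
  by move/eqP; rewrite subr_eq0 => /eqP.
move=> /(IHs _ vz)[p [x [xs px xp]]]; exists (('X - z%:P) * p), x.
by rewrite rmorphM /= mulmxA in_cons xs orbT.
Qed.

(** The degree bounds every multiplicity by [n], so one exponent serves all roots. *)
Lemma char_poly_dvd_prod_roots (F : closedFieldType) (n : nat) (f : 'M[F]_n) :
  exists s : seq F, [/\ uniq s, forall z, (z \in s) = eigenvalue f z &
    char_poly f %| \prod_(z <- s) ('X - z%:P) ^+ n].
Proof.
have [rs rsE] := closed_field_poly_normal (char_poly f).
move: rsE; rewrite (monicP (char_poly_monic f)) scale1r => rsE.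
have szrs : size rs = n.
  by have := size_char_poly f; rewrite rsE size_prod_XsubC => -[].
exists (undup rs); split; first exact: undup_uniq.
  by move=> z; rewrite mem_undup eigenvalue_root_char rsE root_prod_XsubC.
rewrite rsE -prodr_undup_exp_count.
elim/big_ind2: _ => // [p q p' q' pq pq'|z _]; first exact: dvdp_mul.
by rewrite dvdp_exp2l // -[leqRHS]szrs count_size.
Qed.

(** * Contractions for Hermitian forms *)

Section HermitianForms.
Variable C : numClosedFieldType.

Definition nsq n (x : 'rV[C]_n) : C := \sum_j `|x 0 j| ^+ 2.

Lemma nsq_ge0 n (x : 'rV[C]_n) : 0 <= nsq x.
Proof. by apply: sumr_ge0 => j _; rewrite exprn_ge0. Qed.

Lemma nsq_eq0 n (x : 'rV[C]_n) : nsq x = 0 -> x = 0.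
Proof.
move=> x0; apply/rowP => j; rewrite mxE; apply/eqP.
rewrite -normr_eq0 -sqrf_eq0; apply/eqP.
by apply: (psumr_eq0P _ x0) => // i _; rewrite exprn_ge0.
Qed.

Lemma nsqZ n a (x : 'rV[C]_n) : nsq (a *: x) = `|a| ^+ 2 * nsq x.
Proof. by rewrite mulr_sumr; apply: eq_bigr => j _; rewrite mxE normrM exprMn. Qed.

(** Young's inequality: in each coordinate, the gap left after the triangle inequality is
    [d * (|a| - |b| / d) ^+ 2]. *)
Lemma nsqD_le n d (x y : 'rV[C]_n) : 0 < d ->
  nsq (x + y) <= (1 + d) * nsq x + (1 + d^-1) * nsq y.
Proof.
move=> d0; rewrite !mulr_sumr -big_split; apply: ler_sum => j _ /=.
rewrite mxE; set a := x 0 j; set b := y 0 j.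
have dn0 : d != 0 by rewrite gt_eqF.
apply: (@le_trans _ _ ((`|a| + `|b|) ^+ 2)).
  by rewrite ler_sqr ?nnegrE ?addr_ge0 // ler_normD.
rewrite -subr_ge0.
have -> : (1 + d) * `|a| ^+ 2 + (1 + d^-1) * `|b| ^+ 2 - (`|a| + `|b|) ^+ 2 =
   d * (`|a| - `|b| / d) ^+ 2 by field.
by rewrite mulr_ge0 ?(ltW d0) // real_exprn_even_ge0 //
  rpredB ?rpredM ?rpredV ?normr_real ?gtr0_real.
Qed.

(** Used with [a = |l|^2] and [b = r^2]. The choice of [d] keeps [d * a] below half of the gap
    [b - a], and [t] makes the last summand exactly half of it. *)
Lemma geometric_weight (a b : C) : 0 <= a -> a < b ->
  exists d t, [/\ 0 < d, 0 < t & (1 + d) * a + (1 + d^-1) / t <= b].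
Proof.
move=> a0 ab; have ba : 0 < b - a by rewrite subr_gt0.
have a1 : 0 < a + 1 by rewrite ltr_wpDl.
pose d := (b - a) / (2 * (a + 1)); have d0 : 0 < d by rewrite divr_gt0 ?mulr_gt0.
pose t := 2 * (1 + d^-1) / (b - a).
have c0 : 0 < 1 + d^-1 by rewrite addr_gt0 ?invr_gt0.
exists d, t; split=> //; first by rewrite divr_gt0 ?mulr_gt0.
have -> : (1 + d^-1) / t = (b - a) / 2.
  rewrite /t; have [cn0 bn0] := (lt0r_neq0 c0, lt0r_neq0 ba).
  by move: (1 + d^-1) cn0 => c cn0; field; rewrite cn0 bn0.
rewrite -subr_ge0.
have -> : b - ((1 + d) * a + (b - a) / 2) = (b - a) / 2 * (a + 1)^-1.
  by rewrite /d; field; rewrite gt_eqF.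
by rewrite mulr_ge0 ?divr_ge0 ?invr_ge0 // ltW.
Qed.

(** Since [N = l + Z], the [k]-th vector becomes [l *: (y *m Z ^+ k) + y *m Z ^+ k.+1]. Young's
    inequality bounds the growth by [(1 + d) |l|^2], plus [(1 + d^-1) / t] for the shifted terms. *)
Lemma weighted_orbit_contraction n (N : 'M[C]_n.+1) (m : nat) (l r : C) :
  `|l| <= r ->
  exists2 t, 0 < t & forall y : 'rV_n.+1,
    y *m (N - l%:M) ^+ m = 0 -> (`|l| = r -> y *m (N - l%:M) = 0) ->
    \sum_(k < m) t ^+ k * nsq (y *m N *m (N - l%:M) ^+ k) <=
    r ^+ 2 * \sum_(k < m) t ^+ k * nsq (y *m (N - l%:M) ^+ k).
Proof.
set Z := N - l%:M => lr.
have step (y : 'rV_n.+1) k : y *m N *m Z ^+ k = l *: (y *m Z ^+ k) + y *m Z ^+ k.+1.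
  rewrite -[N](subrK l%:M) -/Z mulmxDr mulmxDl addrC mul_mx_scalar -scalemxAl.
  by rewrite -mulmxA exprS mulmxE.
move: lr; rewrite le_eqVlt => /orP[/eqP lr|lr].
  (* When [|l| = r], [Z] kills [y], so [N] acts on [y] as the scalar [l] and the weight can be 1. *)
  exists 1 => // y _ /(_ lr) yZ; rewrite mulr_sumr; apply: ler_sum => k _.
  rewrite step exprS -mulmxE mulmxA yZ mul0mx addr0 nsqZ lr.
  by rewrite mulrCA.
have r0 : 0 <= r by rewrite (le_trans (normr_ge0 l)) // ltW.
have lr2 : `|l| ^+ 2 < r ^+ 2 by rewrite ltr_sqr ?nnegrE.
have [|d [t [d0 t0 dt]]] := geometric_weight _ lr2; first by rewrite exprn_ge0.
exists t => // y yZ _; pose F k := t ^+ k * nsq (y *m Z ^+ k).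
have F0 k : 0 <= F k by rewrite mulr_ge0 ?nsq_ge0 ?exprn_ge0 // ltW.
(* The shift drops [F 0 >= 0] and gains [F m], which is zero because [y *m Z ^+ m = 0]. *)
have Fle : \sum_(k < m) F k.+1 <= \sum_(k < m) F k.
  rewrite -(lerD2l (F 0%N)) -(big_ord_recl m (fun k => F k)) big_ord_recr /=.
  rewrite [F m]/F yZ addrC lerD2r.
  have -> : nsq (0 : 'rV[C]_n.+1) = 0.
    by rewrite /nsq big1 // => j _; rewrite mxE normr0 expr0n.
  by rewrite mulr0.
apply: (@le_trans _ _ (((1 + d) * `|l| ^+ 2) * \sum_(k < m) F k +
    (1 + d^-1) / t * \sum_(k < m) F k.+1)); last first.
  apply: (@le_trans _ _ (((1 + d) * `|l| ^+ 2 + (1 + d^-1) / t) * \sum_(k < m) F k)).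
    by rewrite [leRHS]mulrDl lerD2l ler_wpM2l // divr_ge0 ?addr_ge0 ?invr_ge0 // ltW.
  by rewrite ler_wpM2r // sumr_ge0.
rewrite !mulr_sumr -big_split /=; apply: ler_sum => k _; rewrite step.
apply: (@le_trans _ _ (t ^+ k * ((1 + d) * nsq (l *: (y *m Z ^+ k)) +
   (1 + d^-1) * nsq (y *m Z ^+ k.+1)))).
  by rewrite ler_wpM2l ?exprn_ge0 ?nsqD_le // ltW.
rewrite nsqZ /F le_eqVlt; apply/orP; left; apply/eqP.
by rewrite [t ^+ k.+1]exprS; field; rewrite !gt_eqF.
Qed.

Local Notation form := (form (@Num.conj C)).

Definition hermitian_mx n (H : 'M[C]_n) := map_mx Num.conj H^T = H.

Lemma hform_sym n (H : 'M[C]_n) u v :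
  hermitian_mx H -> form H u v = (form H v u)^*%R.
Proof.
move=> hH; have sH : H = (-1) ^+ false *: map_mx Num.conj H^T by rewrite expr0 scale1r.
by rewrite (formC (@conjCK C) (introT (sesquiP _ _ _) sH)) expr0 mul1r.
Qed.

Lemma hform_scale n (H : 'M[C]_n) a u :
  form H (a *: u) (a *: u) = `|a| ^+ 2 * form H u u.
Proof. by rewrite formZ normCK. Qed.

Lemma contraction_eigenvalue n (H N : 'M[C]_n) (r : C) :
    hermitian_mx H -> (forall u, u != 0 -> 0 < form H u u) -> 0 <= r ->
    (forall u, form H (u *m N) (u *m N) <= r ^+ 2 * form H u u) ->
  (forall l, eigenvalue N l -> `|l| <= r) /\
  (forall l, `|l| = r -> forall u : 'rV_n,
    u *m (N - l%:M) *m (N - l%:M) = 0 -> u *m (N - l%:M) = 0).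
Proof.
move=> hH posH r0 leH; split=> [l /eigenvalueP[u ul u0]|l lr u].
  rewrite -ler_sqr ?nnegrE // -(ler_pM2r (posH u u0)) -hform_scale -ul.
  exact: leH.
set w := u *m _ => wl; apply/eqP/negP => /negP w0.
have ww := posH w w0.
(* Gram-Schmidt: only a multiple of the eigenvector [w] is added, so [y *m N = l *: y + w] holds
   just as it does for [u]. *)
pose y := u + (- form H u w / form H w w) *: w.
have yw : form H y w = 0.
  by rewrite formDl formZl mulfVK ?gt_eqF // subrr.
have yN : y *m N = l *: y + w.
  have wN : w *m N = l *: w.
    by apply/eqP; rewrite -subr_eq0 -mul_mx_scalar -mulmxBr wl.
  rewrite mulmxDl -scalemxAl wN scalerDr !scalerA [_ * l]mulrC addrAC.
  congr (_ + _); by rewrite /w mulmxBr mul_mx_scalar addrC subrK.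
have := leH y; clearbody y;
rewrite yN formDl !formDr hform_scale lr [form H w (_ *: _)]hform_sym //.
rewrite !formZl yw mulr0 conjC0 addr0 add0r gerDl => /le_lt_trans/(_ ww).
by rewrite ltxx.
Qed.

Definition gram n (G : 'M[C]_n) := G *m map_mx Num.conj G^T.

Lemma gram_form n (G : 'M[C]_n) u : form (gram G) u u = nsq (u *m G).
Proof.
rewrite /form /gram mulmxA -mulmxA -map_mxM -trmx_mul mxE.
by apply: eq_bigr => j _; rewrite !mxE normCK.
Qed.

Lemma gram_herm n (G : 'M[C]_n) : hermitian_mx (gram G).
Proof.
apply/matrixP=> i j; rewrite !mxE rmorph_sum; apply: eq_bigr => k _.
by rewrite !mxE rmorphM /= conjCK mulrC.
Qed.

Lemma hermitian_mx_sum n I (s : seq I) (c : I -> C) (H : I -> 'M[C]_n) :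
  (forall i, 0 <= c i) -> (forall i, hermitian_mx (H i)) ->
  hermitian_mx (\sum_(i <- s) c i *: H i).
Proof.
move=> c0 hH; rewrite /hermitian_mx raddf_sum raddf_sum; apply: eq_bigr => i _.
by rewrite /= linearZ /= map_mxZ /= hH geC0_conj.
Qed.

Lemma form_sum n I (s : seq I) (c : I -> C) (H : I -> 'M[C]_n) u v :
  form (\sum_(i <- s) c i *: H i) u v = \sum_(i <- s) c i * form (H i) u v.
Proof.
rewrite /form mulmx_sumr mulmx_suml summxE; apply: eq_bigr => i _.
by rewrite -scalemxAr -scalemxAl mxE.
Qed.

(** The block of a single [l]: [Q] commutes with [N], so the orbit estimate applies to [u *m Q].
    Since [0 < m], the term [k = 0] is present and detects [u *m Q = 0]. *)
Lemma exists_semidefinite_contraction n (N : 'M[C]_n.+1) (r l : C) (m : nat)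
    (q : {poly C}) :
    `|l| <= r -> horner_mx N q *m (N - l%:M) ^+ m = 0 ->
    (`|l| = r -> horner_mx N q *m (N - l%:M) = 0) -> (0 < m)%N ->
  exists H, [/\ hermitian_mx H, forall u, 0 <= form H u u,
    forall u, form H (u *m N) (u *m N) <= r ^+ 2 * form H u u &
    forall u, form H u u = 0 -> u *m horner_mx N q = 0].
Proof.
move=> lr Qm Q1 m0; set Q := horner_mx N q in Qm Q1 *; set Z := N - l%:M in Qm Q1 *.
have [t t0 tP] := weighted_orbit_contraction N m lr.
have cQ : Q *m N = N *m Q by apply: comm_horner_mx.
pose H := \sum_(k < m) t ^+ k *: gram (Q *m Z ^+ k).
have formE u : form H u u = \sum_(k < m) t ^+ k * nsq (u *m Q *m Z ^+ k).
  by rewrite form_sum; apply: eq_bigr => k _; rewrite gram_form mulmxA.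
have term0 u (k : 'I_m) : 0 <= t ^+ k * nsq (u *m Q *m Z ^+ k).
  by rewrite mulr_ge0 ?nsq_ge0 // exprn_ge0 // ltW.
exists H; split.
- apply: hermitian_mx_sum => k; last exact: gram_herm.
  by rewrite exprn_ge0 // ltW.
- by move=> u; rewrite formE sumr_ge0.
- move=> u; rewrite !formE -[u *m N *m Q]mulmxA -cQ mulmxA; apply: tP.
    by rewrite -mulmxA Qm mulmx0.
  by move=> /Q1 QZ; rewrite -mulmxA QZ mulmx0.
- move=> u; rewrite formE => /psumr_eq0P/(_ (Ordinal m0) isT)/eqP.
  by rewrite expr0 mul1r mulmx1 => /(_ _)/eqP/nsq_eq0; apply.
Qed.

(** Bounds with a common [r] add up, and a sum of nonnegative forms vanishes only where each of them
    does. *)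
Lemma exists_common_contraction n (N : 'M[C]_n.+1) (r : C) (s : seq C)
    (q : C -> {poly C}) (m : nat) :
    (0 < m)%N ->
    (forall l, l \in s -> [/\ `|l| <= r,
       horner_mx N (q l) *m (N - l%:M) ^+ m = 0 &
       `|l| = r -> horner_mx N (q l) *m (N - l%:M) = 0]) ->
  exists H, [/\ hermitian_mx H, forall u, 0 <= form H u u,
    forall u, form H (u *m N) (u *m N) <= r ^+ 2 * form H u u &
    forall u, form H u u = 0 -> forall l, l \in s -> u *m horner_mx N (q l) = 0].
Proof.
move=> m0; elim: s => [|l s IHs] sP.
  exists 0; split=> // [|u|u]; first by rewrite /hermitian_mx trmx0 map_mx0.
    by rewrite form0_eq0.
  by rewrite !form0_eq0 // mulr0.
have [|H1 [h1 p1 c1 z1]] := IHs.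
  by move=> x xs; apply: sP; rewrite in_cons xs orbT.
have [lr lm l1] := sP l (mem_head l s).
have [H2 [h2 p2 c2 z2]] := exists_semidefinite_contraction lr lm l1 m0.
have fD u : form (H1 + H2) u u = form H1 u u + form H2 u u.
  by rewrite /form mulmxDr mulmxDl mxE.
exists (H1 + H2); split=> [|u|u|u].
- by rewrite /hermitian_mx raddfD /= map_mxD h1 h2.
- by rewrite fD addr_ge0.
- by rewrite !fD mulrDr lerD.
- rewrite fD => /eqP; rewrite paddr_eq0 // => /andP[/eqP/z1 u1 /eqP/z2 u2] x.
  by rewrite in_cons => /predU1P[->|/u1].
Qed.

Lemma exists_contraction n (N : 'M[C]_n) (r : C) :
    (forall l, eigenvalue N l -> `|l| <= r) ->
    (forall l, eigenvalue N l -> `|l| = r -> forall u : 'rV_n,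
      u *m (N - l%:M) *m (N - l%:M) = 0 -> u *m (N - l%:M) = 0) ->
  exists H, [/\ hermitian_mx H, forall u, u != 0 -> 0 < form H u u &
    forall u, form H (u *m N) (u *m N) <= r ^+ 2 * form H u u].
Proof.
(* Evaluating polynomials at [N] requires positive size; in size 0 there is no nonzero vector and
   [H = 0] works. *)
case: n N => [|n] N eig_le eig_ss.
  have f0 u : form (0 : 'M[C]_0) u u = 0 by rewrite form0_eq0.
  exists 0; split=> [|u|u]; first by rewrite /hermitian_mx trmx0 map_mx0.
    by rewrite thinmx0 eqxx.
  by rewrite !f0 mulr0.
have [s [us sE sdvd]] := char_poly_dvd_prod_roots N.
pose q l := \prod_(z <- s | z != l) ('X - z%:P) ^+ n.+1.
(* Restoring the factor omitted from [q l] gives a multiple of the characteristic polynomial. *)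
have Q0 l : l \in s -> horner_mx N (q l) *m (N - l%:M) ^+ n.+1 = 0.
  move=> ls; have -> : N - l%:M = horner_mx N ('X - l%:P).
    by rewrite rmorphB /= horner_mx_X horner_mx_C.
  rewrite mulmxE -rmorphXn -rmorphM /= mulrC /q -(bigD1_seq l) //=.
  have [p ->] := dvdpP _ _ sdvd.
  by rewrite rmorphM /= Cayley_Hamilton mulr0.
(* [eig_ss] passes from the square to the first power; iterating it descends from any power. *)
have descent l (u : 'rV_n.+1) k : l \in s -> `|l| = r ->
    u *m (N - l%:M) ^+ k.+1 = 0 -> u *m (N - l%:M) = 0.
  rewrite sE => eigl lr; elim: k => [|k IHk]; first by rewrite expr1.
  rewrite !exprSr -!mulmxE !mulmxA => /(eig_ss _ eigl lr).
  by rewrite -mulmxA mulmxE -exprSr => /IHk.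
have [|H [hH pH cH zH]] := @exists_common_contraction n N r s q n.+1 isT.
  move=> l ls; split; [by apply: eig_le; rewrite -sE | exact: Q0 | move=> lr].
  apply/row_matrixP=> i; rewrite row_mul row0; apply: (descent _ _ n ls lr).
  by rewrite -row_mul Q0 // row0.
exists H; split=> // u u0; rewrite lt0r pH andbT; apply/negP => /eqP/zH uq.
have [rs] := closed_field_poly_normal (char_poly N).
rewrite (monicP (char_poly_monic N)) scale1r => rsE.
(* The eigenvector [u *m horner_mx N p] is still killed by [q z], yet [q z] acts on it as the scalar
   [(q z).[z]], which is nonzero. *)
have [|p [z [_ up upN]]] := exists_eigenvector_horner (f := N) (s := rs) u0.
  by rewrite -rsE Cayley_Hamilton mulmx0.
have zs : z \in s by rewrite sE; apply/eigenvalueP; exists (u *m horner_mx N p).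
have := horner_mx_eigenvector (q z) upN.
rewrite -mulmxA mulmxE (comm_horner_mx2 N p (q z)) -mulmxE mulmxA uq // mul0mx.
move=> /esym/eqP; rewrite scaler_eq0 (negPf up) orbF horner_prod prodf_seq_eq0 => /hasP[x _].
by rewrite horner_exp expf_eq0 hornerXsubC subr_eq0 eq_sym => /and3P[/negPf->].
Qed.

End HermitianForms.

(** * Real inner products as symmetric positive definite matrices *)

(** At [x = y] this is syntactically the expression in [sym_posdef] and [possemidef], so their
    inequalities fold into it. *)
Definition bil (R : realType) n (P : 'M[R]_n) (x y : 'cV[R]_n) : R :=
  (x^T *m P *m y) 0 0.

Section BilinearForms.
Variables (R : realType) (n : nat).
Implicit Types (P Q A : 'M[R]_n) (x y : 'cV[R]_n).

Lemma bilDl P y : {morph bil P ^~ y : u v / u + v}.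
Proof. by move=> u v; rewrite /bil raddfD /= !mulmxDl mxE. Qed.

Lemma bilDr P x : {morph bil P x : u v / u + v}.
Proof. by move=> u v; rewrite /bil !mulmxDr mxE. Qed.

Lemma bilZl P a x y : bil P (a *: x) y = a * bil P x y.
Proof. by rewrite /bil linearZ /= -!scalemxAl mxE. Qed.

Lemma bilZr P a x y : bil P x (a *: y) = a * bil P x y.
Proof. by rewrite /bil -!scalemxAr mxE. Qed.

Lemma bilC P x y : P^T = P -> bil P x y = bil P y x.
Proof.
move=> sP; rewrite /bil -[in RHS](trmxK (y^T *m P *m x)) [RHS]mxE.
by rewrite !trmx_mul trmxK sP mulmxA.
Qed.

Lemma bilDm P Q x y : bil (P + Q) x y = bil P x y + bil Q x y.
Proof. by rewrite /bil mulmxDr mulmxDl mxE. Qed.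

Lemma bilNm P x y : bil (- P) x y = - bil P x y.
Proof. by rewrite /bil mulmxN mulNmx mxE. Qed.

Lemma bilZm a P x y : bil (a *: P) x y = a * bil P x y.
Proof. by rewrite /bil -scalemxAr -scalemxAl mxE. Qed.

Lemma bil_mull A P x y : bil (A^T *m P) x y = bil P (A *m x) y.
Proof. by rewrite /bil trmx_mul !mulmxA. Qed.

Lemma bil_mulr A P x y : bil (P *m A) x y = bil P x (A *m y).
Proof. by rewrite /bil !mulmxA. Qed.

Lemma bil_ge0 P x : sym_posdef P -> 0 <= bil P x x.
Proof.
by case=> _ posP; have [->|/posP/ltW//] := eqVneq x 0; rewrite /bil mulmx0 mxE.
Qed.

Lemma hilbert_normP (N : 'cV[R]_n -> R) :
  hilbert_norm N <->
  exists2 P, sym_posdef P & forall x, N x = Num.sqrt (bil P x x).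
Proof.
split=> [[ip NE]|[P [symP posP] NE]].
  pose e (i : 'I_n) : 'cV[R]_n := delta_mx i 0.
  (* The Gram matrix of the inner product in the standard basis. *)
  pose P := \matrix_(i, j) ip (e i) (e j).
  have xE x : x = \sum_i x i 0 *: e i.
    by rewrite [LHS]matrix_sum_delta; apply: eq_bigr => i _; rewrite big_ord1.
  have ipC x y : ip x y = ip y x by rewrite hermitian_subproof expr0 mul1r.
  have ip_sumr x (I : Type) (s : seq I) (F : I -> 'cV[R]_n) :
      ip x (\sum_(i <- s) F i) = \sum_(i <- s) ip x (F i).
    exact: linear_sumr.
  have ipZr x a y : ip x (a *: y) = a * ip x y by rewrite linearZr_LR.
  have ipE x y : ip x y = bil P x y.
    rewrite [in LHS](xE y) ip_sumr /bil mxE; apply: eq_bigr => j _.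
    rewrite ipZr mulrC ipC [in LHS](xE x) ip_sumr mxE; congr (_ * _).
    by apply: eq_bigr => i _; rewrite ipZr ipC !mxE.
  exists P; last by move=> x; rewrite NE ipE.
  split; first by apply/matrixP=> i j; rewrite !mxE ipC.
  by move=> x x0; rewrite -/(bil P x x) -ipE neq0_dnorm_gt0.
have bilP : bilinear_for ( *%R) (idfun \; *%R) (bil P).
  by split=> [u|u] a x y /=; rewrite ?bilDl ?bilDr ?bilZl ?bilZr.
pose B1 := bilinear_isBilinear.Build R _ _ _ _ _ (bil P) bilP.
pose B2 := isHermitianSesquilinear.Build R _ false idfun (bil P)
   (fun x y => etrans (bilC x y symP) (esym (mul1r _))).
pose B3 := isDotProduct.Build R _ (bil P) posP.
pose ip : {dot 'cV[R]_n for idfun} := HB.pack (bil P) B1 B2 B3.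
by exists ip.
Qed.

End BilinearForms.

(** * Complexification *)

Section Transfer.
Variables (R : realType) (n : nat).
Implicit Types (P M : 'M[R]_n) (x y : 'cV[R]_n).
Local Notation toC := (map_mx (real_complex R)).
Local Notation form := (form (@Num.conj R[i])).

Lemma conj_realC (a : R) : (a%:C)^*%R = a%:C.
Proof. exact: conjc_real. Qed.

Lemma form_real (H : 'M[R[i]]_n) x y :
  form H (toC x^T) (toC y^T) = ((toC x)^T *m H *m toC y) 0 0.
Proof.
rewrite /form map_trmx; congr ((_ *m _) 0 0).
by apply/matrixP=> i j; rewrite !mxE /= conj_realC.
Qed.

Lemma form_bil P x y : form (toC P) (toC x^T) (toC y^T) = (bil P x y)%:C.
Proof. by rewrite form_real map_trmx -!map_mxM mxE. Qed.

(** The cross terms ['i * bil P y x] and [- 'i * bil P x y] cancel by symmetry. *)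
Lemma form_complex P x y : P^T = P ->
  form (toC P) (toC x^T + 'i *: toC y^T) (toC x^T + 'i *: toC y^T) =
  (bil P x x + bil P y y)%:C.
Proof.
move=> symP; rewrite formDl !formDr !formZl !formZr !form_bil (bilC x y symP).
rewrite /= conjCi rmorphD /=.
have := sqrCi R[i]; rewrite expr2 => ii; ring: ii.
Qed.

Lemma complex_row (u : 'rV[R[i]]_n) :
  exists x y, u = toC x^T + 'i *: toC y^T.
Proof.
exists (\col_i complex.Re (u 0 i)), (\col_i complex.Im (u 0 i)).
by apply/rowP => i; rewrite !mxE [LHS]complexE.
Qed.

Lemma hermitian_of_real P : P^T = P -> hermitian_mx (toC P).
Proof.
move=> symP; apply/matrixP=> i j.
by rewrite !mxE /= conj_realC -[in RHS]symP mxE.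
Qed.

Lemma sym_posdef_complex P : sym_posdef P ->
  forall u, u != 0 -> 0 < form (toC P) u u.
Proof.
move=> Ppos u; have [x [y ->]] := complex_row u; have [symP posP] := Ppos.
rewrite form_complex // ltcR => u0.
have [x0|/posP x0] := eqVneq x 0; last by rewrite ltr_wpDr ?bil_ge0.
have [y0|/posP y0] := eqVneq y 0; last by rewrite ltr_wpDl ?bil_ge0.
by move: u0; rewrite x0 y0 trmx0 map_mx0 scaler0 addr0 eqxx.
Qed.

Lemma contraction_complex P M (k : R) : P^T = P ->
  (forall x, bil P (M *m x) (M *m x) <= k * bil P x x) ->
  forall u, form (toC P) (u *m toC M^T) (u *m toC M^T) <= k%:C * form (toC P) u u.
Proof.
move=> symP cM u; have [x [y ->]] := complex_row u.
rewrite mulmxDl -scalemxAl -!map_mxM -!trmx_mul !form_complex //.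
by rewrite -rmorphM lecR mulrDr lerD.
Qed.

Lemma real_of_form (H : 'M[R[i]]_n) x :
  bil (map_mx (@complex.Re R) H) x x = complex.Re (form H (toC x^T) (toC x^T)).
Proof.
rewrite form_real /bil !mxE raddf_sum; apply: eq_bigr => j _.
rewrite !mxE mulr_suml mulr_suml raddf_sum; apply: eq_bigr => i _.
by rewrite !mxE /=; case: (H i j) => a b /=; rewrite !(mul0r, mulr0, subr0, addr0).
Qed.

(** Take for [P] the entrywise real part of [H]: it is symmetric because [H] is Hermitian, and on
    real vectors its quadratic form is the real part of that of [H]. *)
Lemma exists_real_contraction (H : 'M[R[i]]_n) M (k : R) :
    hermitian_mx H -> (forall u, u != 0 -> 0 < form H u u) ->
    (forall u, form H (u *m toC M^T) (u *m toC M^T) <= k%:C * form H u u) ->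
  exists2 P, sym_posdef P & forall x, bil P (M *m x) (M *m x) <= k * bil P x x.
Proof.
move=> hH posH cH; exists (map_mx (@complex.Re R) H).
  split.
    by apply/matrixP=> i j; rewrite !mxE -[in LHS]hH !mxE; case: (H i j).
  move=> x x0; rewrite -/(bil _ x x) real_of_form.
  have /posH : toC x^T != 0 by rewrite map_mx_eq0 trmx_eq0.
  by rewrite ltcE => /andP[].
move=> x; rewrite !real_of_form trmx_mul map_mxM.
have := cH (toC x^T); rewrite lecE => /andP[_].
by case: (form H (toC x^T) (toC x^T)) => a b /=; rewrite mul0r subr0.
Qed.

End Transfer.

(** * The cycle of implications (i), (ii), (iii), (iv), (i) *)

Theorem lemma4 (R : realType) (n : nat) (A : 'M[R]_n) (eta : R)
    (eta_gt0 : 0 < eta) (eta_lt1 : eta < 1) :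
  [<-> exists2 N : 'cV[R]_n -> R,
         hilbert_norm N & averaged eta N (fun x => A *m x);
       exists2 P : 'M[R]_n, sym_posdef P &
         loewner_le (A^T *m P *m A)
           ((2 * eta - 1) *: P + (1 - eta) *: (A^T *m P + P *m A));
       exists2 N : 'cV[R]_n -> R, hilbert_norm N &
         nonexpansive N (fun x => ((1 - 1 / eta)%:M + (1 / eta) *: A) *m x);
       (forall z : R[i], complex_eigenvalue A z -> in_disk eta z) /\
       (forall z : R[i], complex_eigenvalue A z -> on_disk_boundary eta z ->
          semisimple_eigenvalue A z)].
Proof.
have eta0 : eta != 0 by rewrite gt_eqF.
set c := 1 - eta.
have NK (N : 'cV[R]_n -> R) P x : sym_posdef P ->
    (forall x, N x = Num.sqrt (bil P x x)) -> N x ^+ 2 = bil P x x.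
  by move=> Ppos ->; rewrite sqr_sqrtr ?bil_ge0.
(* With [p], [q], [s] the products of [x] with [x], of [x] with [A x], and of [A x] with [A x], (ii)
   says that the slack [(2 eta - 1) p + 2 (1 - eta) q - s] is nonnegative. *)
have bil_loewner P x : P^T = P ->
   bil ((2 * eta - 1) *: P + c *: (A^T *m P + P *m A) - A^T *m P *m A) x x =
   (2 * eta - 1) * bil P x x + c * (2 * bil P x (A *m x)) - bil P (A *m x) (A *m x).
  move=> symP; rewrite !(bilDm, bilZm, bilNm, bil_mull, bil_mulr).
  rewrite (bilC (A *m x) x symP); ring.
have N_M : map_mx (real_complex R) (A - c%:M)^T = (to_complex A)^T - c%:C%:M.
  by rewrite raddfB /= tr_scalar_mx map_mxB map_scalar_mx map_trmx.
have eigE l : eigenvalue (map_mx (real_complex R) (A - c%:M)^T) l <->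
    complex_eigenvalue A (l + c%:C).
  by rewrite N_M eigenvalue_shift.
have ssE l : semisimple_eigenvalue A (l + c%:C) <->
    forall u : 'rV_n, let N := map_mx (real_complex R) (A - c%:M)^T in
    u *m (N - l%:M) *m (N - l%:M) = 0 -> u *m (N - l%:M) = 0.
  rewrite /semisimple_eigenvalue /algebraic_multiplicity -char_poly_trmx.
  rewrite mup_eigenspace_rank /= N_M -addrA -opprD -raddfD [c%:C + l]addrC.
  by [].
tfae.
- move=> [N /hilbert_normP[P Ppos NE] [_ avN]]; exists P => //.
  have [symP posP] := Ppos; split.
    rewrite raddfB raddfD /= !linearZ /= raddfD /= !trmx_mul trmxK symP mulmxA.
    by rewrite [P *m A + _]addrC.
  move=> x; rewrite -/(bil _ x x) bil_loewner //.
  (* The slack is [eta] times the averagedness gap between [x] and 0. *)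
  have := avN x 0; rewrite mulmx0 !subr0 !(NK _ P) //.
  have -> : x - A *m x = x + (-1) *: (A *m x) by rewrite scaleN1r.
  rewrite !bilDl !bilDr !bilZl !bilZr (bilC (A *m x) x symP) /c.
  set p := bil P x x; set q := bil P x _; set s := bil P _ _ => h.
  have -> : (2 * eta - 1) * p + (1 - eta) * (2 * q) - s = eta *
    (p - (1 - eta) / eta * (p + -1 * q + (-1 * q + -1 * (-1 * s))) - s) by field.
  by rewrite mulr_ge0 ?subr_ge0 // ltW.
- move=> [P Ppos [_ leP]]; have [symP posP] := Ppos.
  exists (fun x => Num.sqrt (bil P x x)); first by apply/hilbert_normP; exists P.
  move=> x y /=; rewrite -mulmxBr; move: (x - y) => u {x y}.
  rewrite ler_wsqrtr // mulmxDl mul_scalar_mx -scalemxAl.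
  rewrite !bilDl !bilDr !bilZl !bilZr (bilC (A *m u) u symP).
  have := leP u; rewrite -/(bil _ u u) bil_loewner // /c.
  set p := bil P u u; set q := bil P u _; set s := bil P _ _ => h.
  (* The slack is also [eta^2] times the gap in the nonexpansiveness inequality, on squared
     norms. *)
  rewrite -(ler_pM2l (mulr_gt0 eta_gt0 eta_gt0)) -subr_ge0.
  by rewrite [leRHS](_ : _ = (2 * eta - 1) * p + (1 - eta) * (2 * q) - s) //; field.
- move=> [N /hilbert_normP[P Ppos NE] neN]; have [symP posP] := Ppos.
  have cM x : bil P ((A - c%:M) *m x) ((A - c%:M) *m x) <= eta ^+ 2 * bil P x x.
    have := neN x 0; rewrite mulmx0 !subr0.
    (* Scaling by [eta] turns nonexpansiveness of [A_eta] into the Lipschitz bound [eta] for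
       [A - c]. *)
    have -> : A - c%:M = eta *: ((1 - 1 / eta)%:M + (1 / eta) *: A).
      rewrite scalerDr scalerA scale_scalar_mx -raddfN /= addrC.
      by congr (_%:M + _); rewrite ?/c; [field | rewrite mul1r divff ?scale1r].
    rewrite -scalemxAl bilZl bilZr mulrA -expr2 ler_pM2l ?exprn_gt0 //.
    by rewrite -!(NK N P) // ler_sqr // nnegrE NE sqrtr_ge0.
  have [||disk ss] := contraction_eigenvalue (hermitian_of_real symP)
    (sym_posdef_complex Ppos) (r := eta%:C) (N := map_mx (real_complex R) (A - c%:M)^T).
  + by rewrite ler0c ltW.
  + by rewrite -rmorphXn; apply: contraction_complex.
  split=> z.
    by rewrite -[z](subrK c%:C) -eigE => /disk; rewrite /in_disk addrK.
  rewrite -[z](subrK c%:C) /on_disk_boundary addrK => _ /ss h.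
  by apply/ssE.
- move=> [disk ss].
  have [||H [hH posH cH]] := @exists_contraction _ _
    (map_mx (real_complex R) (A - c%:M)^T) eta%:C.
  + by move=> l /eigE/disk; rewrite /in_disk addrK.
  + move=> l /eigE/ss h lr; apply/ssE/h.
    by rewrite /on_disk_boundary addrK.
  rewrite -rmorphXn in cH.
  have [P Ppos cM] := exists_real_contraction hH posH cH.
  have [symP posP] := Ppos.
  pose N x := Num.sqrt (bil P x x).
  exists N; first by apply/hilbert_normP; exists P.
  have av x y : N (A *m x - A *m y) ^+ 2 <=
    N (x - y) ^+ 2 - (1 - eta) / eta * N (x - A *m x - (y - A *m y)) ^+ 2.
    have -> : x - A *m x - (y - A *m y) = (x - y) - A *m (x - y).
      by rewrite mulmxBr !opprB addrACA [RHS]addrACA [- (A *m x) - y]addrC.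
    rewrite -mulmxBr; move: (x - y) => u {x y}.
    rewrite !(NK _ P) //; have := cM u; rewrite mulmxBl mul_scalar_mx.
    have -> : u - A *m u = u + (-1) *: (A *m u) by rewrite scaleN1r.
    rewrite -scaleNr !bilDl !bilDr !bilZl !bilZr (bilC (A *m u) u symP) /c.
    set p := bil P u u; set q := bil P u _; set s := bil P _ _ => h.
    (* [eta] times the averagedness gap equals [eta^2 |u|^2 - |(A - c) u|^2], nonnegative by [h]. *)
    rewrite -(ler_pM2l eta_gt0) -subr_ge0.
    by rewrite [leRHS](_ : _ = eta ^+ 2 * p - (s + - (1 - eta) * q +
      (- (1 - eta) * q + - (1 - eta) * (- (1 - eta) * p)))) ?subr_ge0 //; field.
  split=> //; exists 1 => // x y.
  rewrite mul1r -ler_sqr ?nnegrE ?sqrtr_ge0 //; apply: le_trans (av x y) _.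
  by rewrite gerBl mulr_ge0 ?sqr_ge0 // divr_ge0 ?subr_ge0 // ltW.
Qed.
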